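(* Let $m$ be an odd positive integer not divisible by $3$ and let $a,d_1,d_2,d_3\in\mathbb{Z}/m\mathbb{Z}$ be such that $d_1$, $d_2$, $d_3$, $d_2-d_1$, $d_3-d_2$ and $d_1-d_3$ are invertible. Then the arithmetic tetrahedron $\mathrm{AS}(a,(d_1,d_2,d_3),s)$ is balanced for all positive integers $s\equiv 0$, $-1$ or $-2\pmod m$.
   Context: $\mathrm{AS}(a,(d_1,d_2,d_3),s)=\{a+i_1d_1+i_2d_2+i_3d_3: i\in\mathbb{N}^3,\ i_1+i_2+i_3\le s-1\}$ as a multiset of $\mathbb{Z}/m\mathbb{Z}$. A multiset is balanced if every element of $\mathbb{Z}/m\mathbb{Z}$ occurs in it with the same multiplicity. *)

(* Defs.v *)
From mathcomp Require Import all_boot all_order all_algebra.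
From mathcomp Require Import finmap multiset.
Set Implicit Arguments.
Unset Strict Implicit.
Unset Printing Implicit Defensive.
Import GRing.Theory.
Local Open Scope ring_scope.
Local Open Scope mset_scope.

(* For a positive integer m = n.+1, Z/mZ is represented by 'I_n.+1 with its    *)
(* additive group structure and the multiplication Zp_mul. The ring 'Z_m is   *)
(* not used because 'Z_1 is Z/2Z, whereas m = 1 has to be the trivial ring,   *)
(* in which 0 is invertible.                                                  *)

Definition invertible_mod (n : nat) (x : 'I_n.+1) : Prop :=
  exists y : 'I_n.+1, Zp_mul x y = Zp1.

(* Every i in N^3 with i_1 + i_2 + i_3 <= s - 1 and 0 < s has its coordinates *)
(* in 'I_s.                                                                   *)
Definition AS (n : nat) (a : 'I_n.+1) (d : 'I_n.+1 * 'I_n.+1 * 'I_n.+1)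
    (s : nat) : {mset 'I_n.+1} :=
  let: (d1, d2, d3) := d in
  seq_mset [seq a + d1 *+ i.1.1 + d2 *+ i.1.2 + d3 *+ i.2
           | i : 'I_s * 'I_s * 'I_s <- enum {: 'I_s * 'I_s * 'I_s}
           & (i.1.1 + i.1.2 + i.2 <= s - 1)%N].

Definition balanced (n : nat) (A : {mset 'I_n.+1}) : Prop :=
  forall x y : 'I_n.+1, A x = A y.

(* Main.v *)
Require Import Defs.
From mathcomp Require Import all_boot all_order all_algebra all_field.
From mathcomp Require Import finmap multiset zify ring.
Import GRing.Theory.
Local Open Scope ring_scope.

(** Let [z <> 1] be an [m]-th root of unity and put [x_0 = 1], [x_i = z ^ d_i].
    The sum of [z ^ y] over [y] in [AS(0, (d_1, d_2, d_3), s)] is the complete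
    homogeneous symmetric polynomial of degree [s - 1] in [x_0, ..., x_3].  The
    invertibility hypotheses make these four numbers distinct, so the sum equals
    [\sum_i x_i ^ (s + 2) / \prod_(j <> i) (x_i - x_j)].  When [s + 2] is
    congruent to [r = 0, 1] or [2] modulo [m], one may replace [s + 2] by [r],
    and the result is a divided difference of order 3 of a polynomial of degree
    at most 2, hence zero.  So all nontrivial Fourier coefficients of the
    multiplicity function vanish, i.e. this function is constant. *)

Section CompleteHomogeneous.

Variable F : fieldType.
Implicit Types x y z : F.

(** Complete homogeneous polynomials of degree [s - 1] in 1, x, then 1, x, y, then 1, x, y, z, built
    one variable at a time; the value at [s = 0] is 0. *)
Definition geom1 x (s : nat) : F := \sum_(i < s) x ^+ i.
Definition geom2 x y (s : nat) : F := \sum_(i < s) y ^+ i * geom1 x (s - i).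
Definition geom3 x y z (s : nat) : F := \sum_(i < s) z ^+ i * geom2 x y (s - i).

(** Splitting off the terms free of the newest variable gives the recurrence behind both inductions
    below. *)
Lemma convolution_powS (G : nat -> F) x (s : nat) :
  \sum_(i < s.+1) x ^+ i * G (s.+1 - i)%N
  = G s.+1 + x * \sum_(i < s) x ^+ i * G (s - i)%N.
Proof.
rewrite big_ord_recl expr0 mul1r subn0 mulr_sumr; congr (_ + _).
by apply: eq_bigr => i _; rewrite lift0 subSS exprS mulrA.
Qed.

(** Bialternant formula with cleared denominator: a Vandermonde factor on the left, the expanded
    determinant with rows (1, t, t^(s+1)), t = 1, x, y, on the right. [geom3E] is the analogue with
    rows (1, t, t^2, t^(s+2)). *)
Lemma geom2E x y s :
  (x - 1) * (y - 1) * (y - x) * geom2 x y s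
  = (y - x) - (y - 1) * x ^+ s.+1 + (x - 1) * y ^+ s.+1.
Proof.
elim: s => [|s IHs]; first by rewrite /geom2 big_ord0 !expr1; ring.
rewrite /geom2 convolution_powS -/(geom2 x y s) mulrDr.
rewrite [_ * (y * _)]mulrCA IHs mulrAC [_ * geom1 x _]mulrAC -subrX1 !exprS.
by move: (x ^+ s) (y ^+ s) => X Y; ring.
Qed.

Lemma geom3E x y z s :
  (x - 1) * (y - 1) * (y - x) * ((z - 1) * (z - x) * (z - y)) * geom3 x y z s
  = (y - 1) * (z - 1) * (z - y) * x ^+ s.+2
    - (x - 1) * (z - 1) * (z - x) * y ^+ s.+2
    + (x - 1) * (y - 1) * (y - x) * z ^+ s.+2
    - (y - x) * (z - x) * (z - y).
Proof.
elim: s => [|s IHs]; first by rewrite /geom3 big_ord0 !expr2; ring.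
rewrite /geom3 convolution_powS -/(geom3 x y z s) mulrDr.
rewrite [_ * (z * _)]mulrCA IHs [_ * geom2 x y _]mulrAC geom2E !exprS.
by move: (x ^+ s) (y ^+ s) (z ^+ s) => X Y Z; ring.
Qed.

Lemma geom3_eq0 x y z s r :
    x - 1 != 0 -> y - 1 != 0 -> z - 1 != 0 ->
    y - x != 0 -> z - y != 0 -> x - z != 0 -> (r < 3)%N ->
    x ^+ s.+2 = x ^+ r -> y ^+ s.+2 = y ^+ r -> z ^+ s.+2 = z ^+ r ->
  geom3 x y z s = 0.
Proof.
move=> nx ny nz nyx nzy; rewrite -oppr_eq0 opprB => nzx ltr3 ex ey ez.
have /mulfI : (x - 1) * (y - 1) * (y - x) * ((z - 1) * (z - x) * (z - y)) != 0.
  by rewrite !mulf_neq0.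
apply; rewrite geom3E ex ey ez mulr0.
(* The determinant with rows (1, t, t^2, t^r) has two equal columns. *)
by case: r ltr3 {ex ey ez} => [|[|[|//]]] _; rewrite ?expr0 ?expr1 ?expr2; ring.
Qed.

Lemma geom1_cond x s k :
  (k <= s)%N -> \sum_(i < s | (i < k)%N) x ^+ i = geom1 x k.
Proof. by move=> leks; rewrite /geom1 (big_ord_widen s (fun i => x ^+ i)). Qed.

Lemma geom3_simplex x y z s : (0 < s)%N ->
  \sum_(i : 'I_s * 'I_s * 'I_s | (i.1.1 + i.1.2 + i.2 <= s - 1)%N)
    x ^+ i.1.1 * y ^+ i.1.2 * z ^+ i.2 = geom3 x y z s.
Proof.
move=> s_gt0; rewrite big_mkcond.
rewrite -(pair_bigA _ (fun (p : 'I_s * 'I_s) (k : 'I_s) =>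
  if (p.1 + p.2 + k <= s - 1)%N then x ^+ p.1 * y ^+ p.2 * z ^+ k else 0)) /=.
(* The exponent of z goes outermost, then that of y, to match the nesting of [geom3]. *)
rewrite exchange_big; apply: eq_bigr => k _ /=.
rewrite -(pair_bigA _ (fun i j : 'I_s =>
  if (i + j + k <= s - 1)%N then x ^+ i * y ^+ j * z ^+ k else 0)) /=.
rewrite exchange_big /= /geom2.
rewrite (big_ord_widen s (fun j => y ^+ j * geom1 x (s - k - j)) (leq_subr _ _)).
rewrite mulr_sumr [RHS]big_mkcond; apply: eq_bigr => j _ /=.
case: ifPn => [ltj|]; last first.
  by rewrite -leqNgt => lej; rewrite big1 // => i _; rewrite ifF //; lia.
rewrite -(@geom1_cond x s); last by rewrite -subnDA leq_subr.
rewrite !mulr_sumr [RHS]big_mkcond; apply: eq_bigr => i _ /=.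
have -> : (i + j + k <= s - 1)%N = (i < s - k - j)%N by lia.
by case: ifP => // _; ring.
Qed.

End CompleteHomogeneous.

Section RootsOfUnity.

Variables (F : fieldType) (n : nat) (z : F).
Hypothesis zm : z ^+ n.+1 = 1.

Lemma expr_Zp_add (a b : 'I_n.+1) : z ^+ (a + b)%R = z ^+ a * z ^+ b.
Proof. by rewrite -exprD -(expr_mod (a + b) zm). Qed.

Lemma expr_Zp_muln (a : 'I_n.+1) k : z ^+ (a *+ k)%R = (z ^+ a) ^+ k.
Proof.
by elim: k => [|k IHk]; rewrite ?mulr0n ?expr0 // mulrS expr_Zp_add IHk exprS.
Qed.

(** If u inverts d modulo m, then z = (z^d)^u. *)
Lemma expr_invertible_mod_neq1 (d : 'I_n.+1) :
  z != 1 -> invertible_mod d -> z ^+ d != 1.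
Proof.
move=> nz1 [u du]; apply: contraNneq nz1 => zd1.
have : z ^+ (Zp_mul d u) = z ^+ (Zp1 : 'I_n.+1) by rewrite du.
by rewrite /= !(expr_mod _ zm) exprM zd1 expr1n expr1 => <-.
Qed.

Lemma expr_invertible_mod_sub (d e : 'I_n.+1) :
  z != 1 -> invertible_mod (d - e) -> z ^+ d - z ^+ e != 0.
Proof.
move=> nz1 inv_de; have := expr_invertible_mod_neq1 _ nz1 inv_de.
apply: contraNneq => /subr0_eq eq_de; rewrite -{1}[d](subrK e) in eq_de.
have nze : z ^+ e != 0.
  rewrite expf_neq0 //; apply/eqP => z0; move: zm.
  by rewrite z0 expr0n => /eqP; rewrite eq_sym oner_eq0.
by apply/eqP; apply: (mulIf nze); rewrite mul1r -expr_Zp_add.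
Qed.

End RootsOfUnity.

Lemma sum_seq_mset (R : pzSemiRingType) (T : finType) (l : seq T) (f : T -> R) :
  \sum_x (seq_mset l x)%:R * f x = \sum_(x <- l) f x.
Proof.
under eq_bigr do rewrite mset_seqE.
elim: l => [|y l IHl]; first by rewrite big_nil big1 // => x _; rewrite mul0r.
rewrite big_cons -IHl /=.
under eq_bigr do rewrite natrD mulrDl.
rewrite big_split /= (bigD1 y) //= eqxx mul1r big1 ?addr0 // => x nxy.
by rewrite eq_sym (negPf nxy) mul0r.
Qed.

(* [\sum_x (A x - A m.-1) X ^ x] has degree less than [m - 1], but vanishes at
   the [m - 1] nontrivial [m]-th roots of unity. *)
Lemma balanced_Fourier (n : nat) (A : {mset 'I_n.+1}%mset) :
  (forall z : algC, z ^+ n.+1 = 1 -> z != 1 ->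
     \sum_(x < n.+1) (A x)%:R * z ^+ x = 0) ->
  balanced A.
Proof.
move=> A0; have [w prim_w] := C_prim_root_exists (ltn0Sn n).
pose c (i : nat) : algC := (A (inord i))%:R - (A ord_max)%:R.
pose p := \poly_(i < n) c i.
have p_root z : z ^+ n.+1 = 1 -> z != 1 -> root p z.
  move=> zm nz1; rewrite /root horner_poly.
  (* The shift in [c] makes [c n] vanish, so the sum extends to all residues. *)
  have -> : \sum_(i < n) c i * z ^+ i = \sum_(i < n.+1) c i * z ^+ i.
    rewrite big_ord_recr /= [X in _ + X * _](_ : _ = 0) ?mul0r ?addr0 //.
    by rewrite /c (_ : inord n = ord_max) ?subrr //; apply: val_inj; rewrite /= inordK.
  under eq_bigr do rewrite /c inord_val mulrBl.
  rewrite sumrB A0 // sub0r oppr_eq0 -mulr_sumr.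
  suff -> : \sum_(i < n.+1) z ^+ i = 0 by rewrite mulr0.
  by apply/eqP; move/eqP: (subrX1 z n.+1); rewrite zm subrr eq_sym mulf_eq0
    subr_eq0 (negPf nz1).
have p0 : p = 0.
  apply/eqP; apply: contraT => np0.
  (* The n powers w, ..., w^n are distinct, while a nonzero [p] of size at most n has fewer than n
     roots. *)
  suff /(max_poly_roots np0) lt_n : all (root p) [seq w ^+ k | k <- iota 1 n].
    have : (n < n)%N; last by rewrite ltnn.
    rewrite -[X in (X < _)%N](size_iota 1) -(size_map (fun k => w ^+ k)).
    apply: leq_trans (lt_n _) (size_poly _ _).
    rewrite map_inj_in_uniq ?iota_uniq // => i j.
    rewrite !mem_iota => /andP[_ lti] /andP[_ ltj] /eqP.
    by rewrite (eq_prim_root_expr prim_w) !modn_small // => /eqP.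
  apply/allP => x /mapP[k]; rewrite mem_iota => /andP[k_gt0 ltk] -> {x}.
  apply: p_root; first by rewrite exprAC (prim_expr_order prim_w) expr1n.
  rewrite -(prim_order_dvd prim_w); apply/negP => /dvdn_leq.
  by move=> /(_ k_gt0); rewrite leqNgt ltk.
suff A_max x : A x = A ord_max by move=> x y; rewrite !A_max.
have [ltx|] := ltnP x n; last first.
  by move=> lex; congr (A _); apply: val_inj => /=; have := ltn_ord x; lia.
have /eqP : p`_x = 0 by rewrite p0 coef0.
by rewrite coef_poly ltx /c inord_val subr_eq0 Num.Theory.eqr_nat => /eqP.
Qed.

Theorem theorem3p14 (n : nat) (a d1 d2 d3 : 'I_n.+1)
  (m_odd : odd n.+1) (m_ndvd3 : ~~ (3 %| n.+1)%N)
  (d1_inv : invertible_mod d1)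
  (d2_inv : invertible_mod d2)
  (d3_inv : invertible_mod d3)
  (d21_inv : invertible_mod (d2 - d1))
  (d32_inv : invertible_mod (d3 - d2))
  (d13_inv : invertible_mod (d1 - d3))
  (s : nat) (s_gt0 : (0 < s)%N)
  (s_mod : (s = 0 %[mod n.+1])%Z \/ (s = -1 %[mod n.+1])%Z
           \/ (s = -2 %[mod n.+1])%Z) :
  balanced (AS a (d1, d2, d3) s).
Proof.
apply: balanced_Fourier => z zm nz1.
(* The residues 0, -1, -2 of s give r = 2, 1, 0. *)
have [r ltr3 sr] : exists2 r, (r < 3)%N & s.+2 = r %[mod n.+1].
  case: s_mod => [|[]] /eqP; rewrite eqz_mod_dvd => dvd_s;
    [exists 2 | exists 1 | exists 0] => //; apply/eqP;
    rewrite eqn_mod_dvd //; congr (is_true (_ %| _)%N): dvd_s; lia.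
have zr k : (z ^+ k) ^+ s.+2 = (z ^+ k) ^+ r.
  by rewrite -!exprM !(mulnC k) !exprM; congr (_ ^+ k);
    rewrite -(expr_mod s.+2 zm) sr expr_mod.
rewrite sum_seq_mset big_map big_filter big_enum_cond.
under eq_bigr do rewrite !expr_Zp_add // !expr_Zp_muln // -!mulrA.
(* The base point a only contributes the factor [z ^+ a]. *)
rewrite -mulr_sumr; under eq_bigr do rewrite mulrA.
rewrite geom3_simplex // (@geom3_eq0 _ _ _ _ s r) ?mulr0 //;
  do ?exact: expr_invertible_mod_sub;
  by rewrite subr_eq0 expr_invertible_mod_neq1.
Qed.
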